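(* Let $k$ and $n$ be integers with $k\ge2$ even and $n\ge\max\{3,\frac{k^2}{4}+1\}$. Then \[{\rm bal}(n,K_{1,k})=\left(\frac{k-2}{2}\right)n-\frac{k^2}{8}+\frac k4,\] and ${\rm Bal}(n,K_{1,k})$ contains only one graph, namely the complete $(\frac{k-2}{2},\,n-\frac{k-2}{2})$-split graph.
   Context: $K_{1,k}$ is the star with $k$ edges. A complete $(p,q)$-split graph is a graph whose vertex set has a partition $X\cup Y$ with $|X|=p$, $|Y|=q$, $X$ inducing a complete graph $K_p$, $Y$ independent, and all edges between $X$ and $Y$ present (for $p=0$ it is the edgeless graph on $q$ vertices). A $2$-coloring $E(K_n)=E(R)\cup E(B)$ is a partition of the edges of $K_n$ into red and blue edges, forming the spanning subgraphs $R$ and $B$; $e(\cdot)$ denotes number of edges. For a graph $G$ with $e(G)$ even, a balanced copy of $G$ is a (not necessarily induced) subgraph of $K_n$ isomorphic to $G$ with exactly $e(G)/2$ red and $e(G)/2$ blue edges. ${\rm bal}(n,G)$ is the minimum non-negative integer $s$ such that every $2$-coloring $E(K_n)=E(R)\cup E(B)$ with $\min\{e(R),e(B)\}>s$ contains a balanced copy of $G$. ${\rm Bal}(n,G)$ is the family (up to isomorphism) of $n$-vertex graphs with exactly ${\rm bal}(n,G)$ edges such that a coloring $E(K_n)=E(R)\cup E(B)$ with $\min\{e(R),e(B)\}={\rm bal}(n,G)$ contains no balanced copy of $G$ if and only if $R$ or $B$ is isomorphic to some $H\in{\rm Bal}(n,G)$. *)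

(* Defs.v *)
From HB Require Import structures.
From mathcomp Require Import all_boot all_order all_algebra.

Set Implicit Arguments.
Unset Strict Implicit.
Unset Printing Implicit Defensive.

(* Finite simple graphs with vertex set T: an edge is a 2-element subset. *)

Record sgraph (T : finType) := SGraph {
  edges : {set {set T}};
  edgesP : [forall e in edges, #|e| == 2]
}.

HB.instance Definition _ (T : finType) := [isSub for @edges T].
HB.instance Definition _ (T : finType) := [Finite of sgraph T by <:].

Section Graphs.

Variables T U : finType.

Definition nedges (G : sgraph T) : nat := #|edges G|.

Definition adj (G : sgraph T) (x y : T) : bool := [set x; y] \in edges G.

Definition isomorphic (G : sgraph T) (H : sgraph U) : Prop :=
  exists2 f : T -> U, bijective f & [set f @: e | e : {set T} in edges G] = edges H.

Definition complete_edges : {set {set T}} := [set e : {set T} | #|e| == 2].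

Definition two_coloring (R B : sgraph T) : bool :=
  (edges R :|: edges B == complete_edges) && [disjoint edges R & edges B].

Definition complete_split (p q : nat) (G : sgraph T) : Prop :=
  exists X Y : {set T},
    [/\ X :|: Y = [set: T] /\ [disjoint X & Y],
        #|X| = p /\ #|Y| = q,
        {in X &, forall x y, x != y -> adj G x y},
        {in Y &, forall x y, ~~ adj G x y}
      & {in X & Y, forall x y, adj G x y}].

(* S is the edge set of a (not necessarily induced) subgraph, isomorphic to G,
   of the complete graph on U; the vertices of the subgraph are those of f(G),
   so that isolated vertices of G also need distinct images. *)
Definition is_copy (G : sgraph T) (S : {set {set U}}) : bool :=
  [exists f : {ffun T -> U},
    injectiveb f && (S == [set f @: e | e : {set T} in edges G])].

(* Meant for graphs G with an even number of edges. *)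
Definition has_balanced_copy (G : sgraph T) (R B : sgraph U) : bool :=
  [exists S : {set {set U}},
    [&& is_copy G S,
        #|S :&: edges R| == (nedges G)./2
      & #|S :&: edges B| == (nedges G)./2]].

End Graphs.

(* The star with center 0 and leaves 1, ..., k. *)

Definition star_edges (k : nat) : {set {set 'I_k.+1}} :=
  [set [set ord0; lift ord0 i] | i : 'I_k].

Lemma star_edgesP (k : nat) : [forall e in star_edges k, #|e| == 2].
Proof. by apply/forall_inP => _ /imsetP[i _ ->]; rewrite cards2. Qed.

Definition star (k : nat) : sgraph 'I_k.+1 := SGraph (star_edgesP k).

Section BalancingNumber.

Variables (T : finType) (n : nat) (G : sgraph T).

Definition forces_balanced (s : nat) : bool :=
  [forall R : sgraph 'I_n, forall B : sgraph 'I_n,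
    two_coloring R B && (s < minn (nedges R) (nedges B)) ==>
    has_balanced_copy G R B].

Lemma ex_forces_balanced : exists s, forces_balanced s.
Proof.
exists #|{set 'I_n}|; apply/forallP => R; apply/forallP => B.
by rewrite ltnNge geq_min max_card andbF.
Qed.

Definition bal : nat := ex_minn ex_forces_balanced.

(* Families of graphs up to isomorphism are represented by isomorphism-closed
   sets of graphs on 'I_n. *)
Definition iso_closed (F : {set sgraph 'I_n}) : Prop :=
  forall H H' : sgraph 'I_n, isomorphic H H' -> H \in F -> H' \in F.

(* F is Bal(n, G).  This is a predicate on F because the defining property
   alone need not determine F when 2 bal(n, G) = 'C(n, 2). *)
Definition is_Bal (F : {set sgraph 'I_n}) : Prop :=
  [/\ iso_closed F,
      {in F, forall H, nedges H = bal}
    & forall R B : sgraph 'I_n,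
        two_coloring R B -> minn (nedges R) (nedges B) = bal ->
        (~ has_balanced_copy G R B <->
         exists2 H, H \in F & isomorphic R H \/ isomorphic B H)].

End BalancingNumber.

(* Main.v *)
(** Write k = 2(p + 1).  A coloring has no balanced star iff every vertex has red
    or blue degree at most p.  Let A be the set of vertices of red degree at most p.
    Counting the edges between A and its complement by their color gives
    |A| |V \ A| <= p n, which for n > (p + 1)^2 forces one of the two sets, say
    V \ A, to have at most p elements.  Summing red degrees,
    2 e(R) <= |V \ A| (n - 1) + |A| p <= p (2n - p - 1), and equality forces
    |V \ A| = p with every vertex of V \ A joined in red to all others; the
    vertices of A then have no further red neighbor. *)

Require Import Defs.
From mathcomp Require Import all_boot all_order all_algebra.
From mathcomp Require Import zify lra.
Import GRing.Theory.

Set Implicit Arguments.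
Unset Strict Implicit.
Unset Printing Implicit Defensive.

Lemma exists_subset_card (T : finType) (A : {set T}) m :
  m <= #|A| -> exists2 C : {set T}, C \subset A & #|C| = m.
Proof.
rewrite -bin_gt0 -cards_draws => /card_gt0P[C].
by rewrite inE => /andP[sC /eqP cC]; exists C.
Qed.

(** * Degrees, two-colorings and complete split graphs in terms of adjacency *)

Section GraphTheory.

Variables T U : finType.
Implicit Types (G H R B : sgraph T) (x y v : T).

Lemma edge_card G e : e \in edges G -> #|e| = 2.
Proof. by have /forall_inP GP := edgesP G => /GP/eqP. Qed.

Lemma adj_irr G x : adj G x x = false.
Proof. by apply/negP => /edge_card; rewrite setUid cards1. Qed.

Lemma adj_sym G x y : adj G x y = adj G y x.
Proof. by rewrite /adj setUC. Qed.

Definition deg G x : nat := #|[set y | adj G x y]|.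

Lemma set2_inj x : {in predC1 x &, injective (fun y => [set x; y])}.
Proof.
move=> y z; rewrite !inE => yx zx /setP/(_ y).
by rewrite !inE eqxx orbT (negPf yx) /= => /esym/eqP.
Qed.

Lemma deg_incident G x : deg G x = #|[set e in edges G | x \in e]|.
Proof.
rewrite /deg -(card_in_imset (f := fun y => [set x; y])); last first.
  move=> y z; rewrite !inE => axy axz; apply: set2_inj; rewrite inE.
    by apply: contraTneq axy => ->; rewrite adj_irr.
  by apply: contraTneq axz => ->; rewrite adj_irr.
congr #|pred_of_set _|; apply/setP => e; rewrite inE; apply/imsetP/andP.
  by move=> [y]; rewrite inE => axy ->; split=> //; rewrite set21.
move=> [eG xe]; have /eqP/cards2P[a [b [_ def_e]]] := edge_card eG.
move: xe eG; rewrite def_e !inE => /orP[] /eqP-> eG.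
  by exists b; rewrite ?inE.
by exists a; rewrite ?inE /adj setUC.
Qed.

Lemma handshake G : \sum_x deg G x = (nedges G).*2.
Proof.
under eq_bigr => x _ do rewrite deg_incident -sum1dep_card big_mkcondr.
rewrite exchange_big /= /nedges -muln2 -sum_nat_const.
by apply: eq_bigr => e /edge_card <-; rewrite -sum1_card [RHS]big_mkcond.
Qed.

Lemma deg_sum G x : deg G x = \sum_y adj G x y.
Proof. by rewrite /deg -sum1dep_card big_mkcond. Qed.

Lemma deg_lt G x : deg G x < #|T|.
Proof.
rewrite -cardsT; apply/proper_card/properP; split; first exact: subsetT.
by exists x; rewrite !inE ?adj_irr.
Qed.

(** Every edge is a pair [[set x; y]], so the partition of the edge set amounts to complementary
    adjacency off the diagonal; later proofs use only this form. *)
Lemma two_coloringP R B :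
  reflect (forall x y, x != y -> adj R x y = ~~ adj B x y) (two_coloring R B).
Proof.
apply: (iffP andP) => [[/eqP RB dRB] x y xy | adjRB].
  have := cards2 x y; rewrite xy => xy2.
  have : [set x; y] \in edges R :|: edges B by rewrite RB inE xy2.
  rewrite inE -/(adj R x y) -/(adj B x y).
  have := disjointFr dRB (x := [set x; y]); rewrite -/(adj R x y) -/(adj B x y).
  by case: (adj R x y) => [-> //|_ /= ->].
have adjN (e : {set T}) : #|e| = 2 -> (e \in edges R) = (e \notin edges B).
  move/eqP/cards2P=> [x [y [xy ->]]]; exact: adjRB.
split.
  apply/eqP/setP => e; rewrite !inE; apply/orP/eqP => [[]/edge_card //|/adjN->].
  by case: (e \in edges B); [right | left].
apply/pred0Pn => -[e /andP[/= eR eB]].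
by move: (eR); rewrite adjN ?(edge_card eR) // eB.
Qed.

Lemma two_coloring_sym R B : two_coloring R B = two_coloring B R.
Proof. by rewrite /two_coloring setUC disjoint_sym. Qed.

Lemma deg_coloring R B x : two_coloring R B -> deg R x + deg B x = #|T|.-1.
Proof.
move=> RB; rewrite !deg_sum -big_split /= -(cardsC1 x) -sum1_card [RHS]big_mkcond /=.
apply: eq_bigr => y _; rewrite in_setC1.
have [->|yx] := eqVneq; first by rewrite !adj_irr.
by rewrite (two_coloringP _ _ RB) 1?eq_sym //; case: adj.
Qed.

Lemma nedges_coloring R B :
  two_coloring R B -> (nedges R + nedges B).*2 = #|T| * #|T|.-1.
Proof.
move=> RB; rewrite doubleD -!handshake -big_split /= -sum_nat_const.
by apply: eq_bigr => x _; exact: deg_coloring.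
Qed.

Lemma compl_edgesP G : [forall e in complete_edges T :\: edges G, #|e| == 2].
Proof. by apply/forall_inP => e; rewrite !inE => /andP[]. Qed.

Definition compl G : sgraph T := SGraph (compl_edgesP G).

Lemma two_coloring_compl G : two_coloring G (compl G).
Proof.
by apply/two_coloringP => x y xy; rewrite [adj (compl G) x y]inE inE cards2 xy andbT negbK.
Qed.

(** Trades images of edge sets for adjacency, so that isomorphisms compose and invert pointwise.
    From right to left, surjectivity is what lifts each edge of [H] to an edge of [G]. *)
Lemma isomorphic_adjP G (H : sgraph U) :
  isomorphic G H <->
  exists2 f : T -> U, bijective f & forall x y, adj G x y = adj H (f x) (f y).
Proof.
have im2 (f : T -> U) x y : f @: [set x; y] = [set f x; f y].
  by rewrite imsetU !imset_set1.
split=> [] [f bij_f fE]; exists f => //.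
  have inj_f := bij_inj bij_f; move=> x y.
  by rewrite /adj -im2 -fE mem_imset //; exact: imset_inj.
have [g fK gK] := bij_f.
apply/setP => e; apply/imsetP/idP => [[d dG ->]|eH].
  have /eqP/cards2P[x [y [_ def_d]]] := edge_card dG.
  by rewrite def_d im2; move: dG; rewrite def_d -/(adj G x y) fE.
have /forall_inP/(_ e eH)/cards2P[x [y [_ def_e]]] := edgesP H.
exists [set g x; g y]; last by rewrite im2 !gK.
by rewrite -/(adj G (g x) (g y)) fE !gK /adj -def_e.
Qed.

(** The independent part is the complement of the clique part, so one set [X] and one Boolean
    formula for adjacency suffice: an edge is a pair that meets [X]. *)
Lemma complete_splitP p q G :
  complete_split p q G <->
  exists X : {set T}, [/\ #|X| = p, #|~: X| = q
    & forall x y, adj G x y = (x != y) && ((x \in X) || (y \in X))].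
Proof.
split=> [[X [Y [[XY dXY] [cX cY] aX aY aXY]]] | [X [cX cY aE]]].
  have defY : Y = ~: X.
    apply/setP => x; have := in_setT x; rewrite -XY !inE.
    by have := disjointFr dXY (x := x); case: (x \in X) => [->|] // _ ->.
  exists X; rewrite -defY; split=> // x y.
  have [->|xy] := eqVneq; first by rewrite adj_irr.
  have XYP z : (z \in Y) = (z \notin X) by rewrite defY inE.
  have [xX|xX] := boolP (x \in X); have [yX|yX] := boolP (y \in X) => /=.
  - exact: aX.
  - by apply: aXY; rewrite ?XYP.
  - by rewrite adj_sym; apply: aXY; rewrite ?XYP.
  - by apply/negbTE/aY; rewrite XYP.
exists X, (~: X); rewrite setUCr -setI_eq0 setICr; split=> //.
- by move=> x y xX _ xy; rewrite aE xy xX.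
- by move=> x y; rewrite aE !inE => /negPf-> /negPf->; rewrite andbF.
- move=> x y; rewrite aE inE => xX yX; rewrite xX andbT.
  by apply: contraNneq yX => <-.
Qed.

Lemma exists_complete_split p :
  p <= #|T| -> exists G, complete_split p (#|T| - p) G.
Proof.
rewrite -cardsT => /exists_subset_card[X _ cX].
have GP : [forall e in [set e in complete_edges T | [exists x in X, x \in e]], #|e| == 2].
  by apply/forall_inP => e; rewrite !inE => /andP[].
exists (SGraph GP); apply/complete_splitP; exists X.
split=> // [|x y]; first by rewrite cardsT -(cardsC X) cX addKn.
rewrite /adj !inE cards2 /=; case: (eqVneq x y) => //= _.
apply/exists_inP/orP => [[z zX]|[xX|yX]].
- by rewrite !inE => /orP[]/eqP <-; [left | right].
- by exists x; rewrite ?set21.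
- by exists y; rewrite ?set22.
Qed.

Lemma deg_complete_split p q G : complete_split p q G ->
  exists2 X : {set T}, #|X| = p
    & forall x, deg G x = if x \in X then #|T|.-1 else p.
Proof.
move=> /complete_splitP[X [cX _ aG]]; exists X => // x.
case: ifP => xX.
  rewrite -(cardsC1 x); apply: eq_card => y.
  by rewrite !inE aG xX andbT eq_sym.
rewrite -cX; apply: eq_card => y; rewrite inE aG xX /=.
by have [<-|] := eqVneq; rewrite ?xX.
Qed.

(** The degree sum is p(N - 1) + (N - p)p with N = [#|T|]. Doubling and moving p(p + 1) to the left
    avoid division and truncated subtraction. *)
Lemma nedges_complete_split p q G :
  complete_split p q G -> (nedges G).*2 + p * p.+1 = p * #|T|.*2.
Proof.
move=> /deg_complete_split[X cX dG]; rewrite -handshake.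
rewrite (bigID (mem X)) /=.
rewrite (eq_bigr (fun=> #|T|.-1)) => [|x xX]; last by rewrite dG xX.
rewrite [X in _ + X + _](eq_bigr (fun=> p)) => [|x xX]; last by rewrite dG (negPf xX).
rewrite !sum_nat_const cX.
have -> : #|[pred x | x \notin X]| = #|T| - p.
  by rewrite -cX -(cardC (mem X)) addKn.
have := max_card X; rewrite cX.
case: (#|T|) => [|t]; nia.
Qed.

End GraphTheory.

(** * Isomorphism, and uniqueness of the complete split graph *)

Lemma isomorphic_refl (T : finType) (G : sgraph T) : isomorphic G G.
Proof. by apply/isomorphic_adjP; exists id => //; exists id. Qed.

Section Isomorphism.

Variables T U W : finType.

Lemma isomorphic_sym (G : sgraph T) (H : sgraph U) :
  isomorphic G H -> isomorphic H G.
Proof.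
move=> /isomorphic_adjP[f [g fK gK] fE]; apply/isomorphic_adjP; exists g.
  by exists f.
by move=> x y; rewrite fE !gK.
Qed.

Lemma isomorphic_trans (G : sgraph T) (H : sgraph U) (K : sgraph W) :
  isomorphic G H -> isomorphic H K -> isomorphic G K.
Proof.
move=> /isomorphic_adjP[f bf fE] /isomorphic_adjP[g bg gE].
apply/isomorphic_adjP; exists (g \o f); first exact: bij_comp.
by move=> x y; rewrite fE gE.
Qed.

Lemma isomorphic_nedges (G : sgraph T) (H : sgraph U) :
  isomorphic G H -> nedges G = nedges H.
Proof.
move=> [f bf fE]; rewrite /nedges -fE card_imset //.
exact/imset_inj/bij_inj.
Qed.

Lemma complete_split_iso p q (G : sgraph T) (H : sgraph U) :
  isomorphic G H -> complete_split p q H -> complete_split p q G.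
Proof.
move=> /isomorphic_adjP[f bf fE] /complete_splitP[X [cX cY aE]].
apply/complete_splitP; exists (f @^-1: X); split.
- by rewrite on_card_preimset //; exact: onW_bij.
- by rewrite -preimsetC on_card_preimset //; exact: onW_bij.
- by move=> x y; rewrite fE aE !inE (inj_eq (bij_inj bf)).
Qed.

(** List each vertex set with its clique part first and match equal positions: the bijection
    respects the parts, which determine adjacency. *)
Lemma complete_split_uniq p q (G : sgraph T) (H : sgraph U) :
  complete_split p q G -> complete_split p q H -> isomorphic G H.
Proof.
move=> /complete_splitP[X [cX cY aG]] /complete_splitP[X' [cX' cY' aH]].
have cardTU : #|T| = #|U| by rewrite -(cardsC X) -(cardsC X') cX cX' cY cY'.
pose s := enum X ++ enum (~: X); pose t := enum X' ++ enum (~: X').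
have uniq_enumC (V : finType) (Z : {set V}) : uniq (enum Z ++ enum (~: Z)).
  rewrite cat_uniq !enum_uniq andbT; apply/hasPn => x.
  by rewrite !mem_enum inE.
have s_full x : x \in s by rewrite mem_cat !mem_enum inE orbN.
have size_st : size s = size t by rewrite !size_cat -!cardE cX cX' cY cY'.
have lt_t x : index x s < size t by rewrite -size_st index_mem.
(* The types may be empty, so the default of [nth] is built from [x] through [cardTU]. It is never
   returned, by [lt_t]. *)
pose f x := nth (enum_val (cast_ord cardTU (enum_rank x))) t (index x s).
have inj_f : injective f.
  move=> x y; rewrite /f (set_nth_default (f y)) // [RHS](set_nth_default (f y)) //.
  move/eqP; rewrite nth_uniq ?uniq_enumC // => /eqP.
  by move/(congr1 (nth x s)); rewrite !nth_index.
(* Both lists switch from the clique part to the independent part at position p. *)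
have fX x : (f x \in X') = (x \in X).
  have := lt_t x; rewrite /f nth_cat index_cat mem_enum !size_cat -!cardE cX cX' cY'.
  have [xX|xX] := boolP (x \in X).
    by rewrite -cX cardE index_mem mem_enum xX -mem_enum mem_nth // -cardE cX' -cX
               cardE index_mem mem_enum.
  rewrite [_ < p]ltnNge leq_addr addKn ltn_add2l /= => lt_q; apply: negbTE.
  by rewrite -in_setC -mem_enum mem_nth // -cardE cY'.
apply/isomorphic_adjP; exists f; first by apply: inj_card_bij => //; rewrite cardTU.
by move=> x y; rewrite aG aH !fX (inj_eq inj_f).
Qed.

End Isomorphism.

(** * Balanced stars and degrees in both colors *)

Section BalancedStars.

Variable T : finType.
Implicit Types (R B : sgraph T) (v : T).

Lemma nedges_star k : nedges (star k) = k.
Proof.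
rewrite /nedges card_imset ?card_ord // => i j /setP/(_ (lift ord0 i)).
by rewrite !inE eqxx /= => /esym/eqP/lift_inj.
Qed.

Lemma card_incident_le_deg R v (S : {set {set T}}) :
    {in S, forall e : {set T}, exists y, e = [set v; y]} ->
  #|S :&: edges R| <= deg R v.
Proof.
move=> Sv; apply: leq_trans (leq_imset_card (fun y => [set v; y]) _).
apply/subset_leq_card/subsetP => e; rewrite inE => /andP[/Sv[y ->] eR].
by apply/imsetP; exists y; rewrite ?inE.
Qed.

(** All edges of a star meet its center, whose degree in each color bounds the number of edges of
    that color. Conversely, m red and m blue neighbors of [v] serve as leaves. *)
Lemma balanced_starP m R B : two_coloring R B ->
  reflect (exists v, m <= deg R v /\ m <= deg B v)
          (has_balanced_copy (star m.*2) R B).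
Proof.
move=> RB; rewrite /has_balanced_copy nedges_star doubleK.
apply: (iffP existsP) => [[S /and3P[/existsP[f /andP[/injectiveP inj_f /eqP defS]]]]|].
  move=> /eqP SR /eqP SB; exists (f ord0).
  suff Sv : {in S, forall e : {set T}, exists y, e = [set f ord0; y]}.
    have le_deg G := card_incident_le_deg G Sv.
    by split; [apply: leq_trans (le_deg R) | apply: leq_trans (le_deg B)];
      rewrite ?SR ?SB.
  move=> e; rewrite defS => /imsetP[_ /imsetP[i _ ->] ->].
  by exists (f (lift ord0 i)); rewrite imsetU !imset_set1.
move=> [v [mR mB]].
have [C /subsetP sC cC] := exists_subset_card mR.
have [D /subsetP sD cD] := exists_subset_card mB.
have CR y : y \in C -> adj R v y by move/sC; rewrite inE.
have DB y : y \in D -> adj B v y by move/sD; rewrite inE.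
have adjRB y : adj R v y -> ~~ adj B v y.
  have [<-|vy] := eqVneq v y; first by rewrite adj_irr.
  by rewrite (two_coloringP _ _ RB).
have neqv y : y \in C :|: D -> y != v.
  by rewrite inE => /orP[/CR|/DB]; apply: contraTneq => ->; rewrite adj_irr.
(* The center comes first, as vertex 0 of the star; then [nth] along [t] is the embedding, injective
   because [t] has no repetition. *)
pose t := v :: enum C ++ enum D.
have uniq_t : uniq t.
  rewrite /= cat_uniq !enum_uniq andbT mem_cat !mem_enum -in_setU.
  apply/andP; split; first by apply/negP => /neqv; rewrite eqxx.
  apply/hasPn => y; rewrite /= !mem_enum => yD.
  by apply/negP => /CR/adjRB/negP; apply; exact: DB.
have size_t : size t = m.*2.+1 by rewrite /= size_cat -!cardE cC cD addnn.
pose f : {ffun 'I_m.*2.+1 -> T} := [ffun i : 'I__ => nth v t i].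
(* Stated for a color [G] and its opposite [G'], so that it counts the red edges with [Z] = [C] and
   the blue ones with [Z] = [D]. *)
have star_card (Z : {set T}) G G' : two_coloring G G' -> Z \subset C :|: D ->
    {in Z, forall y, adj G v y} -> {in (C :|: D) :\: Z, forall y, adj G' v y} ->
  #|[set [set v; y] | y in C :|: D] :&: edges G| = #|Z|.
  move=> GG' sZ ZG ZG'.
  rewrite -(card_in_imset (f := fun y => [set v; y])); last first.
    move=> y z /(subsetP sZ)/neqv yv /(subsetP sZ)/neqv zv.
    by apply: set2_inj; rewrite inE.
  apply: eq_card => e; rewrite inE; apply/andP/imsetP => [[/imsetP[y yCD ->]]|].
    rewrite -/(adj G v y) => vyG; exists y => //; apply/negPn/negP => yZ.
    have := ZG' y; rewrite inE yZ yCD => /(_ isT).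
    by have := two_coloringP _ _ GG' v y; rewrite eq_sym neqv // vyG => /(_ isT); case: adj.
  move=> [y yZ ->]; split; last exact: ZG.
    by apply/imsetP; exists y; rewrite ?(subsetP sZ).
exists [set [set v; y] | y in C :|: D]; apply/and3P; split.
- apply/existsP; exists f; apply/andP; split.
    apply/injectiveP => i j; rewrite !ffunE => /eqP.
    by rewrite nth_uniq ?size_t // => /eqP/val_inj.
  rewrite -imset_comp; apply/eqP/setP => e; apply/imsetP/imsetP => [[y yCD ->]|[i _ ->]].
    have yt : y \in enum C ++ enum D by rewrite mem_cat !mem_enum -in_setU.
    have lt_y : index y (enum C ++ enum D) < m.*2.
      by rewrite -ltnS -size_t ltnS index_mem.
    by exists (Ordinal lt_y); rewrite //= imsetU !imset_set1 !ffunE /= nth_index.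
  exists (nth v (enum C ++ enum D) i).
    have : nth v (enum C ++ enum D) i \in enum C ++ enum D.
      by rewrite mem_nth // size_cat -!cardE cC cD addnn.
    by rewrite mem_cat !mem_enum -in_setU.
  by rewrite /= imsetU !imset_set1 !ffunE.
- rewrite (star_card C _ B) ?subsetUl ?cC //.
  by move=> y; rewrite !inE => /andP[/negPf->] /=; exact: DB.
- rewrite (star_card D _ R) ?subsetUr ?cD //; first by rewrite two_coloring_sym.
  by move=> y; rewrite !inE orbC => /andP[/negPf->] /=; exact: CR.
Qed.

Lemma has_balanced_copy_sym (W : finType) (G : sgraph W) R B :
  has_balanced_copy G R B = has_balanced_copy G B R.
Proof. by apply: eq_existsb => S; rewrite [X in _ && X]andbC. Qed.

(** Vertices of the clique part have blue degree 0 and all others have red degree p, so no vertex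
    reaches p + 1 in both colors. *)
Lemma complete_split_no_balanced_star p q R B :
    two_coloring R B -> complete_split p q R ->
  ~~ has_balanced_copy (star p.+1.*2) R B.
Proof.
move=> RB /deg_complete_split[X _ dR]; apply/(balanced_starP _ RB) => -[v [pR pB]].
have := deg_coloring v RB; rewrite dR in pR *; case: ifP pR => _; last by rewrite ltnn.
by move=> _; case: (deg B v) pB => // d _ /eqP; rewrite -[X in _ == X]addn0 eqn_add2l.
Qed.

End BalancedStars.

(** * Edge bound for colorings without a balanced star, and the case of equality *)

Section Extremal.

Variables (T : finType) (p : nat).
Implicit Types (R B : sgraph T).
Hypothesis cardT : p.+1 ^ 2 < #|T|.

(* Each of the |A||V \ A| cross edges is red at a vertex of A or blue at a vertex
   outside A, so there are at most p|V| of them. *)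
Lemma low_degree_class_small R B (A := [set v | deg R v <= p]) :
    two_coloring R B -> (forall v, deg R v <= p \/ deg B v <= p) ->
  #|~: A| <= p \/ #|A| <= p.
Proof.
move=> RB lowRB.
have sum_deg_le G (C D : {set T}) : {in C, forall v, deg G v <= p} ->
    \sum_(x in C) \sum_(y in D) adj G x y <= #|C| * p.
  move=> lowC; rewrite -sum_nat_const; apply: leq_sum => x xC.
  apply: leq_trans (lowC x xC); rewrite deg_sum.
  by rewrite [leqRHS](bigID (mem D)) leq_addr.
have cross : #|A| * #|~: A| <= #|A| * p + #|~: A| * p.
  have leA := sum_deg_le R A (~: A); have leC := sum_deg_le B (~: A) A.
  apply: leq_trans (leq_add (leA _) (leC _)); last first.
  - by move=> v; rewrite !inE => /negPf vA; case: (lowRB v); rewrite ?vA.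
  - by move=> v; rewrite inE.
  rewrite [X in _ <= _ + X]exchange_big -big_split /= -sum_nat_const.
  apply: leq_sum => x xA; rewrite -big_split /= -sum1_card.
  apply: leq_sum => y; rewrite inE => yA.
  rewrite (two_coloringP _ _ RB) ?[adj B y x]adj_sym; first by case: adj.
  by apply: contraNneq yA => <-.
(* Put a = [#|A|], b = [#|~: A|] and N = a + b. The bound [cross] reads (a - p)(b - p) <= p^2. If
   both factors were at least 1, their product would be at least their sum minus 1, that is N - 2p -
   1, which exceeds p^2. *)
have := cardsC A; nia.
Qed.

(** With b = [#|~: A|] and N = [#|T|], the degree sum is at most b(N - 1) + (N - b)p. This increases
    strictly with b since N - 1 > p, so its maximum is at b = p and equality forces both b = p and
    full degree on [~: A]. *)
Lemma nedges_few_high_degree R (A := [set v | deg R v <= p]) :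
  #|~: A| <= p ->
  (nedges R).*2 + p * p.+1 <= p * #|T|.*2
  /\ ((nedges R).*2 + p * p.+1 = p * #|T|.*2 -> complete_split p (#|T| - p) R).
Proof.
move=> bp; rewrite -handshake (bigID (mem A)) /=.
have SA : \sum_(x in A) deg R x <= #|A| * p.
  by rewrite -sum_nat_const; apply: leq_sum => x; rewrite inE.
have deg_le x : deg R x <= #|T|.-1.
  by rewrite -ltnS prednK ?deg_lt // (leq_ltn_trans _ (deg_lt R x)).
have SC : \sum_(x in ~: A) deg R x <= #|~: A| * #|T|.-1
    ?= iff [forall (x | x \in ~: A), deg R x == #|T|.-1].
  by rewrite -sum_nat_const; apply: leqif_sum => x _; split.
have -> : \sum_(x | x \notin A) deg R x = \sum_(x in ~: A) deg R x.
  by apply: eq_bigl => x; rewrite !inE.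
have cA := cardsC A; have [leC eqC] := SC.
split; first by case: #|T| cA leC cardT => [|t] /=; nia.
move=> eqE.
have cCA : #|~: A| = p by case: #|T| cA leC cardT eqE => [|t] /=; nia.
have : \sum_(x in ~: A) deg R x == #|~: A| * #|T|.-1.
  by case: #|T| cA leC cardT eqE => [|t] /=; nia.
rewrite eqC => /forall_inP degC.
have adjC x y : x \in ~: A -> x != y -> adj R x y.
  move=> /degC/eqP dx xy.
  (* The neighborhood of [x] lies in [[set~ x]] and has the same size. *)
  have /setP/(_ y) : [set z | adj R x z] = [set~ x].
    apply/eqP; rewrite eqEcard cardsC1 -dx leqnn andbT.
    by apply/subsetP => z; rewrite !inE; apply: contraTneq => ->; rewrite adj_irr.
  by rewrite !inE eq_sym xy.
apply/complete_splitP; exists (~: A); split=> //.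
  by rewrite setCK -cA cCA addnK.
move=> x y; have [<-|xy] := eqVneq; first by rewrite adj_irr.
have [xC|xA] := boolP (x \in ~: A); first exact: adjC.
have [yC|yA] := boolP (y \in ~: A); first by rewrite adj_sym adjC // eq_sym.
(* Here [x] is in [A]: its at most p neighbors include all p vertices of [~: A], so there are no
   others. *)
have /setP/(_ y) : ~: A = [set z | adj R x z].
  apply/eqP; rewrite eqEcard cCA; apply/andP; split; last first.
    by move: xA; rewrite in_setC negbK inE.
  apply/subsetP => z zC; rewrite inE adj_sym adjC //.
  by apply: contraNneq xA => <-.
by rewrite [in RHS]inE (negPf yA).
Qed.

Lemma unbalanced_star_coloring R B :
    two_coloring R B -> ~~ has_balanced_copy (star p.+1.*2) R B ->
  exists2 G, G = R \/ G = B &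
    (nedges G).*2 + p * p.+1 <= p * #|T|.*2
    /\ ((nedges G).*2 + p * p.+1 = p * #|T|.*2 -> complete_split p (#|T| - p) G).
Proof.
move=> RB /(balanced_starP _ RB) nobal.
have lowRB v : deg R v <= p \/ deg B v <= p.
  case: (leqP (deg R v) p) => [|pR]; first by left.
  by case: (leqP (deg B v) p) => [|pB]; [right | case: nobal; exists v].
have [few|few] := low_degree_class_small RB lowRB.
  by exists R; [left | exact: nedges_few_high_degree].
(* The colors swap roles: a vertex of blue degree above p has red degree at most p, hence lies in
   [A], which is small. *)
exists B; [by right | apply: nedges_few_high_degree].
apply: leq_trans few; apply/subset_leq_card/subsetP => v.
by rewrite !inE; case: (lowRB v) => ->.
Qed.

End Extremal.

(** * The balancing number and the extremal family, for a fixed split graph [S] *)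

Section StarBalancingNumber.

Variables (n p : nat) (S : sgraph 'I_n).
Hypothesis n_gt : p.+1 ^ 2 < n.
Hypothesis splitS : complete_split p (n - p) S.

Let cardI : p.+1 ^ 2 < #|'I_n|. Proof. by rewrite card_ord. Qed.

Lemma nedges_split : (nedges S).*2 + p * p.+1 = p * n.*2.
Proof. by have := nedges_complete_split splitS; rewrite card_ord. Qed.

(** Strictly fewer than half of all edges lie in [S]. A color class of that size is thus the
    minority, and the other class has a different size. *)
Lemma nedges_split_lt_half : (nedges S).*2.*2 < n * n.-1.
Proof.
move: nedges_split n_gt; move: (nedges S) => e.
by case: (n) => [|m] //=; nia.
Qed.

Lemma split_minority (R B : sgraph 'I_n) :
  two_coloring R B -> nedges R = nedges S -> minn (nedges R) (nedges B) = nedges S.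
Proof.
move=> RB eR; rewrite eR; apply/minn_idPl.
by have := nedges_coloring RB; have := nedges_split_lt_half; rewrite eR card_ord; lia.
Qed.

Lemma iso_split_complete (G : sgraph 'I_n) :
  isomorphic G S <-> complete_split p (n - p) G.
Proof.
split=> [isoG | splitG]; first exact: complete_split_iso splitS.
exact: complete_split_uniq splitS.
Qed.

(** The edge bound for colorings without a balanced star shows that [nedges S] forces one; the
    coloring of [S] against its complement rules out smaller values. *)
Lemma bal_star : bal n (star p.+1.*2) = nedges S.
Proof.
rewrite /bal; case: ex_minnP => s forces_s min_s.
apply/eqP; rewrite eqn_leq; apply/andP; split.
  apply: min_s; apply/forallP => R; apply/forallP => B; apply/implyP => /andP[RB].
  rewrite ltnNge; apply: contraNT => nobal.
  have [G RBG [leG _]] := unbalanced_star_coloring cardI RB nobal.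
  move: leG; rewrite card_ord -nedges_split leq_add2r leq_double geq_min.
  by case: RBG => -> ->; rewrite ?orbT.
have SC := two_coloring_compl S.
rewrite leqNgt; apply/negP => lt_s; move/forallP/(_ S)/forallP/(_ (compl S))/implyP: forces_s.
rewrite SC split_minority // lt_s => /(_ isT).
by apply/negP; exact: complete_split_no_balanced_star SC splitS.
Qed.

Lemma extremal_star_coloring (R B : sgraph 'I_n) :
    two_coloring R B -> minn (nedges R) (nedges B) = nedges S ->
  ~ has_balanced_copy (star p.+1.*2) R B <-> isomorphic R S \/ isomorphic B S.
Proof.
move=> RB minRB; split=> [/negP nobal | [] /iso_split_complete split_G].
- have [G RBG [leG eqG]] := unbalanced_star_coloring cardI RB nobal.
  have /eqG : (nedges G).*2 + p * p.+1 = p * #|'I_n|.*2.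
    apply/eqP; rewrite eqn_leq leG card_ord -nedges_split leq_add2r leq_double -minRB.
    by rewrite geq_min; case: RBG => ->; rewrite leqnn ?orbT.
  by rewrite card_ord => /iso_split_complete; case: RBG => ->; [left | right].
- by apply/negP; exact: complete_split_no_balanced_star split_G.
- rewrite has_balanced_copy_sym; apply/negP.
  by apply: complete_split_no_balanced_star split_G; rewrite two_coloring_sym.
Qed.

Lemma split_compl_majority (H : sgraph 'I_n) :
  nedges H = nedges S -> nedges (compl H) != nedges S.
Proof.
move=> eH; apply/eqP => eC.
have := nedges_coloring (two_coloring_compl H).
by have := nedges_split_lt_half; rewrite eH eC card_ord addnn => /ltn_eqF/negP nS /eqP.
Qed.

(** Membership is tested on the coloring of a graph against its complement. The characterization of
    extremal colorings leaves open which color is the split graph; [split_compl_majority] settles it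
    by edge count. *)
Lemma is_Bal_star (F : {set sgraph 'I_n}) :
  is_Bal (star p.+1.*2) F <-> (forall H, H \in F <-> isomorphic H S).
Proof.
rewrite /is_Bal bal_star; split=> [[isoF eF noF] H | FS].
  have minF K (eK : nedges K = nedges S) :=
    split_minority (two_coloring_compl K) eK.
  split=> [HF | isoHS].
    have HC := two_coloring_compl H; have minH := minF H (eF H HF).
    have /(extremal_star_coloring HC minH)[//|isoCS] :
        ~ has_balanced_copy (star p.+1.*2) H (compl H).
      by apply/(noF _ _ HC minH); exists H => //; left; exact: isomorphic_refl.
    by case/eqP: (split_compl_majority (eF H HF)); exact: isomorphic_nedges.
  have SC := two_coloring_compl S; have minS := minF S erefl.
  have /(noF _ _ SC minS)[K KF [isoSK|isoCK]] :
      ~ has_balanced_copy (star p.+1.*2) S (compl S).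
    by apply/(extremal_star_coloring SC minS); left; exact: isomorphic_refl.
  - apply: (isoF K) => //; apply: isomorphic_sym.
    exact: isomorphic_trans isoHS isoSK.
  (* Members of [F] have as many edges as [S], which the complement of [S] does not. *)
  - have /eqP[] := split_compl_majority (erefl (nedges S)).
    by rewrite (isomorphic_nedges isoCK) eF.
split=> [H K isoHK /FS isoHS | H /FS/isomorphic_nedges // | R B RB minRB].
  by apply/FS; apply: isomorphic_trans isoHS; exact: isomorphic_sym.
apply: (iff_trans (extremal_star_coloring RB minRB)); split=> [isoS | [H /FS isoHS]].
  by exists S => //; apply/FS; exact: isomorphic_refl.
by case=> isoH; [left | right]; exact: isomorphic_trans isoHS.
Qed.

End StarBalancingNumber.

Local Open Scope ring_scope.

Theorem theorem3p2 (k n : nat) (k_ge2 : (2 <= k)%N) (k_even : ~~ odd k)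
    (n_ge : (maxn 3 (k ^ 2 %/ 4 + 1) <= n)%N) :
  (bal n (star k))%:R
    = (k%:R - 2) / 2 * n%:R - k%:R ^+ 2 / 8 + k%:R / 4 :> rat
  /\ exists2 S : sgraph 'I_n,
       complete_split ((k - 2) %/ 2)%N (n - (k - 2) %/ 2)%N S
     & forall F : {set sgraph 'I_n},
         is_Bal (star k) F <-> (forall H, H \in F <-> isomorphic H S).
Proof.
set p := ((k - 2) %/ 2)%N.
(* With k = 2(p + 1), k^2/4 is exactly (p + 1)^2, so the bound on [n] becomes the strict inequality
   [n_gt]. *)
have def_k : k = p.+1.*2 by rewrite /p; lia.
have n_gt : (p.+1 ^ 2 < n)%N.
  move: n_ge; rewrite geq_max => /andP[_]; rewrite def_k -mul2n expnMn mulKn //.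
  by rewrite addn1.
have p_le : (p <= #|'I_n|)%N by rewrite card_ord; nia.
have [S] := exists_complete_split p_le; rewrite card_ord => splitS.
rewrite def_k; split; last by exists S => //; exact: is_Bal_star.
rewrite (bal_star n_gt splitS).
(* Over the rationals the doubled count gives pn - p(p + 1)/2, which is the stated formula at k =
   2(p + 1). *)
have /(congr1 (fun m => m%:R : rat)) := nedges_split splitS.
rewrite -!muln2 natrD !natrM -[p.+1]addn1 natrD.
lra.
Qed.
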